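(* For every integer $\ell\ge 2$ there exist real constants $\varepsilon>0$, $C$ and $C'>0$, all depending only on $\ell$, such that the following holds. If $\Gamma$ is an $n$-vertex graph that is $(1-\varepsilon,t)$-sparse for some $t\ge 1$, and $\Gamma$ has at least $C\,t^{1-1/\ell}\,n^{1+1/\ell}$ edges, then $\Gamma$ contains at least $C' d^{2\ell}$ induced copies of the cycle $C_{2\ell}$, where $d$ is the average degree of $\Gamma$.
   Context: Graphs are finite and simple, with $n\ge 1$ vertices. For real $c>0$ and $t\ge 1$, a graph $\Gamma$ is called $(c,t)$-sparse if for every pair of vertex subsets $A,B\subseteq V(\Gamma)$ with $|A|,|B|\ge t$ one has $e(A,B)\le (1-c)|A||B|$. Here $A$ and $B$ need not be disjoint, and $e(A,B)$ is the number of edges between $A$ and $B$ with edges inside $A\cap B$ counted twice; that is, $e(A,B)$ is the number of ordered pairs $(a,b)\in A\times B$ with $ab\in E(\Gamma)$. In particular, $(1-\varepsilon,t)$-sparseness means $e(A,B)\le \varepsilon|A||B|$ for all such $A,B$, and the requirement $c=1-\varepsilon>0$ means $\varepsilon<1$. $C_{2\ell}$ denotes the cycle with $2\ell$ vertices. An induced copy of $C_{2\ell}$ in $\Gamma$ is an induced subgraph of $\Gamma$ isomorphic to $C_{2\ell}$ (copies are unlabelled). *)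

(* Defs.v *)
From mathcomp Require Import all_boot all_order all_algebra.
From mathcomp Require Import all_classical all_reals all_analysis.
Set Implicit Arguments.
Unset Strict Implicit.
Unset Printing Implicit Defensive.
Import Order.TTheory GRing.Theory Num.Theory.
Local Open Scope ring_scope.

Definition simple_graph (T : finType) (e : rel T) : Prop :=
  symmetric e /\ irreflexive e.

Definition edges (T : finType) (e : rel T) : {set {set T}} :=
  [set [set p.1; p.2] | p : T * T & e p.1 p.2]%SET.

Definition degree (T : finType) (e : rel T) (x : T) : nat :=
  #|[set y | e x y]%SET|.

Definition avg_degree (R : realType) (T : finType) (e : rel T) : R :=
  (\sum_(x : T) degree e x)%N%:R / #|T|%:R.

(* Ordered pairs are counted, so an edge inside A :&: B contributes twice. *)
Definition edges_between (T : finType) (e : rel T) (A B : {set T}) : nat :=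
  #|[set p : T * T | [&& p.1 \in A, p.2 \in B & e p.1 p.2]]%SET|.

Definition sparse (R : realType) (T : finType) (e : rel T) (c t : R) : Prop :=
  forall A B : {set T}, t <= #|A|%:R -> t <= #|B|%:R ->
    (edges_between e A B)%:R <= (1 - c) * #|A|%:R * #|B|%:R.

(* This is the cycle with m vertices only for 3 <= m. *)
Definition cycle_rel (m : nat) : rel 'I_m :=
  fun i j => (j == ordS i) || (i == ordS j).

Definition isomorphic (T U : finType) (e : rel T) (h : rel U) : Prop :=
  exists2 f : T -> U, bijective f & {mono f : x y / e x y >-> h x y}.

Definition induced (T : finType) (e : rel T) (S : {set T}) :
  rel {x : T | x \in S} := relpre val e.

(* An induced subgraph is determined by its vertex set, so unlabelled induced
   copies of h are represented by their vertex sets. *)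
Definition induced_copies (T U : finType) (e : rel T) (h : rel U) :
  {set {set T}} := [set S : {set T} | `[< isomorphic (@induced T e S) h >]]%SET.

(* Main.v *)
Require Import Defs.
From mathcomp Require Import all_boot all_order all_algebra.
From mathcomp Require Import all_classical all_reals all_analysis.
From mathcomp Require Import ring lra zify.
Set Implicit Arguments.
Unset Strict Implicit.
Unset Printing Implicit Defensive.
Import Order.TTheory GRing.Theory Num.Theory.
Local Open Scope ring_scope.

(** Closed walks of length [2 l] are counted with weights instead of one by
    one, so that irregular degrees do no harm.  A subgraph [e'] of [e] whose
    nonzero degrees are at least a quarter of the average degree [d] is
    weighted by the normalised adjacency matrix
    [M x y = e' x y / sqrt (deg x * deg y)].  Its largest eigenvalue is 1, so
    the total weight [W = tr (M ^ 2l)] of the closed walks is at least 1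
    ([norm_adj_closed_ge1]), while a single one weighs at most
    [(4 / d) ^ 2l].  Hence it suffices that the closed walks having a conflict,
    i.e. two non-consecutive positions carrying equal or adjacent vertices,
    weigh at most [W / 2] in total: a walk free of conflicts traces an induced
    cycle, and every induced cycle is traced by at most [(2 l)!] of them.

    Consider conflicts between positions 0 and [i] with [2 <= i <= l], and let
    [y], [z] be the vertices at positions 1 and [l + 1].  Position 0 and
    position [i] lie inside the two different [l]-walks from [y] to [z] that
    make up the closed walk, so that, given [y] and [z], the two vertices are
    independent samples from two measures of the same mass [M ^ l y z].  Both
    are cut at [eta / t] times this mass ([conflict_pair_bound]).
    - The parts below the cut are spread over at least [t / eta] vertices,
      and sparseness says that they meet in a conflict with probability
      [O(eta)].
    - For the parts above the cut, a measure is bounded by [t / eta] times its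
      square over its mass.  Summed over [y] and [z] this gives
      [t / eta * \sum_x f j x * f (l - j) x], where
      [f j x = (M ^ 2j) x x].  As [j |-> f j x] is a moment sequence it is
      log-convex, so that the product is at most [f 1 x * f (l - 1) x], and
      [f 1 x = O(1 / d)].  There remains [t / d * tr (M ^ (2 l - 2))].

    Log-convexity of the traces interpolates [tr (M ^ (2 l - 2))] between
    [tr (M ^ 2) = O(n / d)] and [W] ([closed_sum_pred]), and
    [t / d * (n / d) ^ (1 / (l - 1))] is small exactly when [d] is large
    compared with [t ^ (1 - 1 / l) * n ^ (1 / l)], which is the assumption on
    the number of edges. *)

(** * Weighted walks and log-convexity *)

Section WeightedWalks.
Context (R : realFieldType) (T : finType).

Lemma sum_sqr_ge0 (I : finType) (a : I -> R) : 0 <= \sum_i a i ^+ 2.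
Proof. by apply: sumr_ge0 => i _; exact: sqr_ge0. Qed.

Lemma sum_CauchySchwarz (I : finType) (a b : I -> R) :
  (\sum_i a i * b i) ^+ 2 <= (\sum_i a i ^+ 2) * (\sum_i b i ^+ 2).
Proof.
set A := \sum_i a i ^+ 2; set B := \sum_i b i ^+ 2; set c := \sum_i _.
have B_ge0 : 0 <= B by exact: sum_sqr_ge0.
(* The multiple by [B] is the sum of the squares of [B * a i - c * b i]. *)
have key : 0 <= B * (A * B - c ^+ 2).
  have -> : B * (A * B - c ^+ 2) = \sum_i (B * a i - c * b i) ^+ 2.
    have -> : \sum_i (B * a i - c * b i) ^+ 2 =
        \sum_i B ^+ 2 * a i ^+ 2 - \sum_i 2 * B * c * (a i * b i)
        + \sum_i c ^+ 2 * b i ^+ 2.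
      by rewrite -sumrB -big_split /=; apply: eq_bigr => i _; ring.
    rewrite -!mulr_sumr -/A -/B -/c; ring.
  exact: sum_sqr_ge0.
have [B0|B_neq0] := eqVneq B 0; last first.
  rewrite -subr_ge0; move: key; rewrite pmulr_rge0 //.
  by rewrite lt_neqAle eq_sym B_neq0.
have b0 i : b i = 0.
  have : \sum_i b i ^+ 2 == 0 by apply/eqP.
  rewrite psumr_eq0; last by move=> j _; exact: sqr_ge0.
  by move=> /allP/(_ i); rewrite mem_index_enum sqrf_eq0 => /(_ isT)/eqP.
rewrite B0 mulr0 /c big1 ?expr0n // => i _.
by rewrite b0 mulr0.
Qed.

(** The entries of the powers of the matrix [M], whose rows and columns are
    indexed by the vertices themselves. *)
Fixpoint walk_sum (M : T -> T -> R) (k : nat) (x y : T) : R :=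
  if k is k'.+1 then \sum_z M x z * walk_sum M k' z y else (x == y)%:R.

(** For symmetric [M] this is the diagonal entry at [x] of the [2k]-th power,
    written so that it is visibly nonnegative. *)
Definition return_sum (M : T -> T -> R) (k : nat) (x : T) : R :=
  \sum_y walk_sum M k x y ^+ 2.

(** The trace of the [2k]-th power of a symmetric [M]. *)
Definition closed_sum (M : T -> T -> R) (k : nat) : R :=
  \sum_x return_sum M k x.

Context (M : T -> T -> R).
Hypothesis M_ge0 : forall x y, 0 <= M x y.
Hypothesis M_sym : forall x y, M x y = M y x.
Notation N := (walk_sum M).
Notation f := (return_sum M).
Notation F := (closed_sum M).

Lemma sum_delta_l (x : T) (g : T -> R) : \sum_z (x == z)%:R * g z = g x.
Proof.
rewrite (bigD1 x) //= eqxx mul1r big1 ?addr0 // => z zx.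
by rewrite eq_sym (negbTE zx) mul0r.
Qed.

Lemma walk_sumS k x y : N k.+1 x y = \sum_z M x z * N k z y.
Proof. by []. Qed.

Lemma walk_sum_ge0 k x y : 0 <= N k x y.
Proof.
elim: k x => [|k IH] x /=; first exact: ler0n.
by apply: sumr_ge0 => z _; apply: mulr_ge0.
Qed.

Lemma walk_sumD j k x y : N (j + k) x y = \sum_z N j x z * N k z y.
Proof.
elim: j x => [|j IH] x /=; first by rewrite sum_delta_l.
under eq_bigr => z _ do rewrite IH mulr_sumr.
rewrite exchange_big /=; apply: eq_bigr => w _.
by rewrite mulr_suml; apply: eq_bigr => z _; rewrite mulrA.
Qed.

Lemma walk_sum1 x y : N 1 x y = M x y.
Proof.
rewrite /= (bigD1 y) //= eqxx mulr1 big1 ?addr0 // => z zy.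
by rewrite (negbTE zy) mulr0.
Qed.

Lemma walk_sum_sym k x y : N k x y = N k y x.
Proof.
elim: k x y => [|k IH] x y; first by rewrite /= eq_sym.
rewrite -[in RHS]addn1 walk_sumD [LHS]/=; apply: eq_bigr => z _.
by rewrite walk_sum1 IH mulrC M_sym.
Qed.

Lemma return_sum_ge0 k x : 0 <= f k x.
Proof. exact: sum_sqr_ge0. Qed.

Lemma closed_sum_ge0 k : 0 <= F k.
Proof. by apply: sumr_ge0 => x _; exact: return_sum_ge0. Qed.

(** The entry of [M ^ 2m] at [(x, x)] can be factored at any intermediate
    step; log-convexity is the Cauchy-Schwarz inequality for such a factoring. *)
Lemma return_sumE j k m x :
  (j + k = m + m)%N -> f m x = \sum_y N j x y * N k x y.
Proof.
move=> jk; have -> : \sum_y N j x y * N k x y = N (j + k) x x.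
  by rewrite walk_sumD; apply: eq_bigr => y _; rewrite (walk_sum_sym k).
rewrite jk walk_sumD; apply: eq_bigr => y _.
by rewrite (walk_sum_sym m y) expr2.
Qed.

Lemma return_sum_logconvex k x : f k.+1 x ^+ 2 <= f k x * f k.+2 x.
Proof.
rewrite (@return_sumE k k.+2); last by lia.
exact: sum_CauchySchwarz.
Qed.

Lemma closed_sum_logconvex k : F k.+1 ^+ 2 <= F k * F k.+2.
Proof.
have E j : F j = \sum_(p : T * T) N j p.1 p.2 ^+ 2.
  exact: (pair_bigA _ (fun x y => N j x y ^+ 2)).
have -> : F k.+1 = \sum_(p : T * T) N k p.1 p.2 * N k.+2 p.1 p.2.
  rewrite -(pair_bigA _ (fun x y => N k x y * N k.+2 x y)) /=.
  by apply: eq_bigr => x _; rewrite (@return_sumE k k.+2) //; lia.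
rewrite (E k) (E k.+2); exact: sum_CauchySchwarz.
Qed.


End WeightedWalks.
Arguments walk_sum : simpl never.

Section LogConvex.
Context (R : realFieldType) (a : nat -> R).
Hypothesis a_ge0 : forall i, 0 <= a i.
Hypothesis a_lc : forall i, a i.+1 ^+ 2 <= a i * a i.+2.

(** The ratios [a i.+1 / a i] increase; the product form also covers
    sequences that vanish somewhere. *)
Lemma logconvex_ratio i d : a i.+1 * a (i + d)%N <= a i * a (i + d).+1.
Proof.
elim: d => [|d IH]; first by rewrite addn0 mulrC.
rewrite addnS; have := a_lc (i + d).
have [z0|nz] := eqVneq (a (i + d)%N) 0.
  rewrite z0 mul0r => h.
  have -> : a (i + d).+1 = 0.
    by apply/eqP; rewrite -sqrf_eq0 eq_le h sqr_ge0.
  by rewrite mulr0 mulr_ge0.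
have pos : 0 < a (i + d)%N by rewrite lt_neqAle eq_sym nz a_ge0.
move=> h; rewrite -(ler_pM2l pos).
apply: (@le_trans _ _ (a i * a (i + d).+1 ^+ 2)).
  by rewrite mulrA (mulrC _ (a i.+1)) expr2 mulrA ler_wpM2r.
by rewrite [leRHS]mulrCA; apply: ler_wpM2l.
Qed.

(** Moving the two indices apart while keeping their sum increases the
    product. *)
Lemma logconvex_spread j k :
  (1 <= j)%N -> (1 <= k)%N -> a j * a k <= a 1%N * a (j + k).-1.
Proof.
wlog jk : j k / (j <= k)%N.
  move=> H hj hk; have [/H->//|/ltnW/H] := leqP j k.
  by rewrite mulrC addnC; apply.
case: j jk => // p; rewrite addSn /= addnC => jk _ _.
elim: p k jk => [|p IH] k jk; first by rewrite addn0.
apply: (@le_trans _ _ (a p.+1 * a k.+1)); last first.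
  by rewrite addnS -addSn; apply: IH; lia.
have := logconvex_ratio p.+1 (k - p.+1).
by have -> : (p.+1 + (k - p.+1) = k)%N by lia.
Qed.

(** [k] is the average of 1 and [k + 1] with weights [1 / k] and
    [(k - 1) / k]. *)
Lemma logconvex_interpolation k :
  (1 <= k)%N -> a k ^+ k <= a 1%N * a k.+1 ^+ k.-1.
Proof.
case: k => // k _; elim: k => [|k IH] /=; first by rewrite expr1 expr0 mulr1.
have [z0|nz] := eqVneq (a k.+2) 0.
  by rewrite z0 expr0n /=; apply: mulr_ge0; rewrite ?exprn_ge0.
have pos : 0 < a k.+2 by rewrite lt_neqAle eq_sym nz a_ge0.
rewrite -(ler_pM2r (exprn_gt0 k pos)) -exprD.
have -> : (k.+2 + k = 2 * k.+1)%N by lia.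
rewrite exprM; apply: le_trans (lerXn2r k.+1 _ _ (a_lc k.+1)) _.
- by rewrite nnegrE sqr_ge0.
- by rewrite nnegrE mulr_ge0.
rewrite exprMn mulrAC; apply: ler_wpM2r; first exact: exprn_ge0.
exact: IH.
Qed.

End LogConvex.

(** * Sparseness for weighted vertices *)

Section SparseBilinear.
Context (R : realType) (T : finType).

Lemma superset_card (B : {set T}) (k : nat) :
  (#|B| <= k)%N -> (k <= #|T|)%N ->
  exists2 B' : {set T}, B \subset B' & #|B'| = k.
Proof.
move=> Bk kT; pose r := take (k - #|B|) (enum (~: B)).
have sub x : x \in r -> x \notin B.
  by move=> /mem_take; rewrite mem_enum inE.
exists (B :|: [set x in r])%SET; first exact: finset.subsetUl.
rewrite cardsU.
have -> : (B :&: [set x in r])%SET = finset.set0.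
  apply/setP => x; rewrite !inE; apply/negbTE/negP => /andP[xB xr].
  by move: (sub _ xr); rewrite xB.
rewrite cards0 subn0 cardsE.
have /card_uniqP -> : uniq r by rewrite take_uniq // enum_uniq.
rewrite size_take -cardE; have := cardsC B.
case: ltnP; lia.
Qed.

(** An average bound over large sets turns into a bound for weights: fewer
    than [k] points exceed the average [c], so these points, padded to a set
    of size [k], contribute at most [m * c * k], and all others at most [c]
    times their weight. *)
Lemma threshold_sum (phi h : T -> R) (c m : R) (k : nat) :
  (0 < k)%N -> (k <= #|T|)%N -> 0 <= c -> 0 <= m ->
  (forall x, 0 <= phi x) -> (forall x, 0 <= h x <= m) ->
  (forall B : {set T}, (k <= #|B|)%N ->
    \sum_(x in B) phi x <= c * #|B|%:R) ->
  \sum_x h x * phi x <= c * (\sum_x h x + k%:R * m).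
Proof.
move=> k0 kT c0 m0 phi0 h01 avg.
pose B := [set x | c < phi x]%SET.
have Bk : (#|B| < k)%N.
  rewrite ltnNge; apply/negP => kB.
  have := avg _ kB; apply/negP; rewrite -ltNge.
  have -> : c * #|B|%:R = \sum_(x in B) c.
    by rewrite sumr_const mulr_natr.
  have /card_gt0P[x0 x0B] : (0 < #|B|)%N by apply: leq_trans k0 kB.
  rewrite (bigD1 x0) //= [ltRHS](bigD1 x0) //=.
  apply: ltr_leD; first by move: x0B; rewrite inE.
  by apply: ler_sum => x /andP[]; rewrite inE => /ltW.
have [B' BB' cB'] := superset_card (ltnW Bk) kT.
have heavy : \sum_(x in B) phi x <= c * k%:R.
  have := avg B'; rewrite cB' => /(_ (leqnn _)); apply: le_trans.
  rewrite [leRHS](big_setID B) /= (finset.setIidPr BB') lerDl.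
  by apply: sumr_ge0.
rewrite (bigID (mem B)) /= mulrDr addrC; apply: lerD.
  apply: (@le_trans _ _ (\sum_(x | x \notin B) c * h x)).
    apply: ler_sum => x; rewrite inE -leNgt => phic.
    by rewrite mulrC; apply: ler_wpM2r => //; case/andP: (h01 x).
  rewrite -mulr_sumr ler_wpM2l //.
  rewrite [leRHS](bigID (mem B)) /= lerDr.
  by apply: sumr_ge0 => x _; case/andP: (h01 x).
apply: (@le_trans _ _ (m * \sum_(x in B) phi x)).
  rewrite mulr_sumr; apply: ler_sum => x _.
  by apply: ler_wpM2r => //; case/andP: (h01 x).
by rewrite mulrA [c * _ * m]mulrC; apply: ler_wpM2l.
Qed.

Lemma edges_betweenE (e : rel T) (A B : {set T}) :
  (edges_between e A B)%:R = \sum_(b in B) \sum_(a in A) (e a b)%:R :> R.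
Proof.
rewrite /edges_between exchange_big /= pair_big /= -sum1_card natr_sum.
rewrite [RHS]big_mkcond [LHS]big_mkcond /=; apply: eq_bigr => -[a b] _ /=.
by rewrite inE /=; case: (a \in A); case: (b \in B); case: (e a b).
Qed.

(** [threshold_sum] applied in both variables; the term [k * m] pays for
    weights that live on fewer than [k] vertices. *)
Lemma sparse_bilinear (e : rel T) (eps t m : R) (k : nat) (g h : T -> R) :
  sparse e (1 - eps) t -> 0 <= eps -> 0 <= m -> t <= k%:R ->
  (0 < k)%N -> (k <= #|T|)%N ->
  (forall x, 0 <= g x <= m) -> (forall x, 0 <= h x <= m) ->
  \sum_a \sum_b g a * h b * (e a b)%:R <=
    eps * (\sum_a g a + k%:R * m) * (\sum_b h b + k%:R * m).
Proof.
move=> sp eps0 m0 tk k0 kT g01 h01.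
have h_sum0 : 0 <= \sum_b h b + k%:R * m.
  apply: addr_ge0; last by apply: mulr_ge0.
  by apply: sumr_ge0 => b _; case/andP: (h01 b).
pose phi a := \sum_b h b * (e a b)%:R.
have -> : \sum_a \sum_b g a * h b * (e a b)%:R = \sum_a g a * phi a.
  apply: eq_bigr => a _; rewrite /phi mulr_sumr.
  by apply: eq_bigr => b _; rewrite mulrA.
rewrite mulrAC; apply: threshold_sum => //.
- by apply: mulr_ge0.
- move=> a; apply: sumr_ge0 => b _; apply: mulr_ge0 => //.
  by case/andP: (h01 b).
move=> A kA; rewrite /phi exchange_big /=.
under eq_bigr => b _ do rewrite -mulr_sumr.
rewrite mulrAC; apply: threshold_sum => //.
- by apply: mulr_ge0.
- by move=> b; apply: sumr_ge0.
move=> B kB; rewrite -edges_betweenE.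
have {1}-> : eps = 1 - (1 - eps) by ring.
by apply: sp; apply: le_trans tk _; rewrite ler_nat.
Qed.

(** The weights [g] and [h] are cut at [m = eta * S / t].  A value above [m]
    is at most [t / (eta * S)] times its square.  The parts below [m] meet
    on the diagonal with weight at most [m * S], and along edges with weight
    at most [4 * eta * S ^ 2] by sparseness, since [k * m <= S]. *)
Lemma conflict_pair_bound (e : rel T) (eta t S : R) (k : nat) (g h : T -> R) :
  sparse e (1 - eta) t -> 0 < eta -> 2 * eta <= 1 -> 1 <= t -> t <= k%:R ->
  k%:R <= 2 * t -> (0 < k)%N -> (k <= #|T|)%N ->
  (forall x, 0 <= g x) -> (forall x, 0 <= h x) ->
  \sum_x g x = S -> \sum_x h x = S ->
  \sum_a \sum_b g a * h b * ((a == b) || e a b)%:R <=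
    t / eta * (\sum_x g x ^+ 2 + \sum_x h x ^+ 2) + 5 * eta * S ^+ 2.
Proof.
move=> sp eta0 eta1 t1 tk kt k0 kT g0 h0 gS hS.
have S0 : 0 <= S by rewrite -gS; apply: sumr_ge0.
have t0 : 0 < t by apply: lt_le_trans t1.
pose m := eta * S / t.
have m0 : 0 <= m by rewrite /m divr_ge0 ?(ltW t0) // mulr_ge0 // ltW.
pose light (u : T -> R) x := if u x <= m then u x else 0.
pose heavy (u : T -> R) x := if u x <= m then 0 else u x.
have light_le u x : (forall y, 0 <= u y) -> 0 <= light u x <= u x.
  by move=> u0; rewrite /light; case: ifP => _; rewrite ?u0 ?lexx.
have lightm u x : (forall y, 0 <= u y) -> 0 <= light u x <= m.
  by move=> u0; rewrite /light; case: ifP => um; rewrite ?u0 ?lexx.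
have heavy0 u x : (forall y, 0 <= u y) -> 0 <= heavy u x.
  by move=> u0; rewrite /heavy; case: ifP.
have heavy_sum u : (forall y, 0 <= u y) ->
    (\sum_x heavy u x) * S <= t / eta * \sum_x u x ^+ 2.
  move=> u0; rewrite mulr_suml mulr_sumr; apply: ler_sum => x _.
  rewrite /heavy; case: (leP (u x) m) => um.
    by rewrite mul0r mulr_ge0 ?sqr_ge0 // divr_ge0 // ltW.
  have -> : S = m * (t / eta) by rewrite /m; field; rewrite !gt_eqF.
  rewrite [leRHS]mulrC mulrA; apply: ler_wpM2r; first by rewrite divr_ge0 // ltW.
  by rewrite expr2 ler_wpM2l // ltW.
(* If one of the two values is heavy it pays alone, whatever the relation. *)
have split_le a b : g a * h b * ((a == b) || e a b)%:R <=
    heavy g a * h b + g a * heavy h b +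
    (light g a * light h b * (a == b)%:R +
     light g a * light h b * (e a b)%:R).
  have prod0 : 0 <= g a * h b by apply: mulr_ge0.
  have le1 : g a * h b * ((a == b) || e a b)%:R <= g a * h b.
    by rewrite ler_piMr // lern1 leq_b1.
  rewrite /heavy /light; case: (leP (g a) m) => _; case: (leP (h b) m) => _.
  - rewrite mul0r mulr0 !add0r -mulrDr ler_wpM2l // -natrD ler_nat.
    by case: (a == b); case: (e a b).
  - by rewrite mul0r add0r mulr0 !mul0r !addr0.
  - by rewrite mulr0 addr0 !mul0r !addr0.
  - by rewrite !mul0r !addr0; apply: le_trans le1 _; rewrite lerDl.
apply: (@le_trans _ _ (\sum_a \sum_b (heavy g a * h b + g a * heavy h b +
    (light g a * light h b * (a == b)%:R +
     light g a * light h b * (e a b)%:R)))).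
  by apply: ler_sum => a _; apply: ler_sum.
under eq_bigr => a _ do rewrite !big_split /=.
rewrite !big_split /=.
have -> : \sum_a \sum_b heavy g a * h b = (\sum_a heavy g a) * S.
  by rewrite mulr_suml; apply: eq_bigr => a _; rewrite -hS mulr_sumr.
have -> : \sum_a \sum_b g a * heavy h b = (\sum_b heavy h b) * S.
  rewrite mulrC -gS mulr_suml; apply: eq_bigr => a _; by rewrite mulr_sumr.
have diag : \sum_a \sum_b light g a * light h b * (a == b)%:R <= eta * S ^+ 2.
  apply: (@le_trans _ _ (\sum_a m * g a)).
    apply: ler_sum => a _.
    rewrite (bigD1 a) //= eqxx mulr1 big1 ?addr0; last first.
      by move=> b ba; rewrite eq_sym (negbTE ba) mulr0.
    rewrite mulrC; have /andP[? ?] := lightm h a h0.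
    by have /andP[? ?] := light_le g a g0; apply: ler_pM.
  rewrite -mulr_sumr gS /m expr2 mulrA ler_wpM2r //.
  by rewrite ler_pdivrMr // ler_peMr // mulr_ge0 // ltW.
have bil : \sum_a \sum_b light g a * light h b * (e a b)%:R <=
    4 * eta * S ^+ 2.
  apply: le_trans (sparse_bilinear sp (ltW eta0) m0 tk k0 kT _ _) _.
  - by move=> x; exact: lightm.
  - by move=> x; exact: lightm.
  have km : k%:R * m <= S.
    apply: (@le_trans _ _ (2 * t * m)); first exact: ler_wpM2r.
    have -> : 2 * t * m = 2 * eta * S by rewrite /m; field; rewrite gt_eqF.
    by rewrite ler_piMl.
  have lS u : (forall y, 0 <= u y) -> \sum_x u x = S ->
      0 <= \sum_x light u x + k%:R * m <= 2 * S.
    move=> u0 uS; apply/andP; split.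
      apply: addr_ge0; last by apply: mulr_ge0.
      by apply: sumr_ge0 => x _; case/andP: (light_le u x u0).
    have -> : 2 * S = S + S by ring.
    rewrite lerD // -[leRHS]uS; apply: ler_sum => x _.
    by case/andP: (light_le u x u0).
  have /andP[g2 g3] := lS g g0 gS; have /andP[h2 h3] := lS h h0 hS.
  have -> : 4 * eta * S ^+ 2 = eta * (2 * S) * (2 * S) by ring.
  by rewrite -[leLHS]mulrA -[leRHS]mulrA ler_wpM2l ?(ltW eta0) // ler_pM.
have := heavy_sum g g0; have := heavy_sum h h0 => hh hg.
rewrite mulrDr; have -> : 5 * eta * S ^+ 2 = eta * S ^+ 2 + 4 * eta * S ^+ 2.
  by ring.
by rewrite !lerD.
Qed.

End SparseBilinear.

(** * Weight of conflicts at a given distance *)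

Section GapConflict.
Context (R : realFieldType) (T : finType) (M : T -> T -> R).
Hypothesis M_sym : forall x y, M x y = M y x.
Notation N := (walk_sum M).
Notation f := (return_sum M).
Notation F := (closed_sum M).

Definition conflict (e : rel T) (a b : T) : bool := (a == b) || e a b.

(** The weight of the closed walks of length [j + k] that have a conflict
    between their start and position [j]; see [sum_cycle_weight_pair]. *)
Definition gap_conflict (e : rel T) (j k : nat) : R :=
  \sum_a \sum_b N j a b * N k b a * (conflict e a b)%:R.

Lemma gap_conflict_sym (e : rel T) j k :
  symmetric e -> gap_conflict e j k = gap_conflict e k j.
Proof.
move=> e_sym; rewrite /gap_conflict exchange_big /=.
apply: eq_bigr => b _; apply: eq_bigr => a _.
by rewrite mulrC (mulrC (N j a b)) /conflict eq_sym e_sym mulrC.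
Qed.

Lemma sum_sqr_through j k :
  \sum_y \sum_z \sum_a (N j y a * N k a z) ^+ 2 = \sum_a f j a * f k a.
Proof.
under eq_bigr => y _ do rewrite exchange_big /=.
rewrite exchange_big /=; apply: eq_bigr => a _.
rewrite mulr_suml; apply: eq_bigr => y _.
rewrite mulr_sumr; apply: eq_bigr => z _.
by rewrite exprMn (walk_sum_sym M_sym j).
Qed.

(** The vertices [y] and [z] cut the closed walk into two [l]-walks which
    contain [a] and [b] respectively as interior vertices. *)
Lemma gap_conflict_split (e : rel T) (l i : nat) :
  (2 <= i <= l)%N ->
  gap_conflict e i (2 * l - i) =
  \sum_y \sum_z \sum_a \sum_b
    (N 1 y a * N l.-1 a z) * (N i.-1 y b * N (l - i.-1) b z)
      * (conflict e a b)%:R.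
Proof.
move=> il; rewrite /gap_conflict.
have Ni a b : N i a b = \sum_y N 1 y a * N i.-1 y b.
  have -> : N i a b = N (1 + i.-1) a b by congr (N _ a b); lia.
  rewrite walk_sumD; apply: eq_bigr => y _.
  by rewrite (walk_sum_sym M_sym 1).
have Nk a b : N (2 * l - i) b a = \sum_z N (l - i.-1) b z * N l.-1 a z.
  have -> : N (2 * l - i) b a = N ((l - i.-1) + l.-1) b a.
    by congr (N _ b a); lia.
  rewrite walk_sumD; apply: eq_bigr => z _.
  by rewrite (walk_sum_sym M_sym l.-1).
under eq_bigr => a _ do under eq_bigr => b _ do
  rewrite Ni Nk big_distrlr /= mulr_suml.
under [RHS]eq_bigr => y _ do rewrite exchange_big /=.
rewrite [RHS]exchange_big /=; apply: eq_bigr => a _.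
under [RHS]eq_bigr => y _ do rewrite exchange_big /=.
rewrite [RHS]exchange_big /=; apply: eq_bigr => b _.
apply: eq_bigr => y _; rewrite mulr_suml; apply: eq_bigr => z _.
congr (_ * _); ring.
Qed.

(** This is where the exponent of the edge threshold comes from:
    [F l.-1 ^ l.-1 <= F 1 * F l ^ (l - 2)] and [F 1 <= n / delta]. *)
Lemma closed_sum_pred (l : nat) (t delta kappa : R) :
  (2 <= l)%N -> 0 <= t -> 0 < delta -> 0 <= kappa -> 1 <= F l ->
  (forall x, f 1 x <= delta^-1) ->
  t ^+ l.-1 * #|T|%:R <= kappa ^+ l.-1 * delta ^+ l ->
  t * (F l.-1 / delta) <= kappa * F l.
Proof.
case: l => [|[|l]] // _ t0 d0 k0 F1 f1 /= h.
have Fge0 := @closed_sum_ge0 R T M.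
rewrite mulrA ler_pdivrMr // -(@ler_pXn2r _ l.+1) ?nnegrE ?mulr_ge0 ?(ltW d0) //.
rewrite !exprMn.
have interp : F l.+1 ^+ l.+1 <= #|T|%:R / delta * F l.+2 ^+ l.+1.
  apply: le_trans (logconvex_interpolation Fge0 (closed_sum_logconvex M_sym) _) _.
    by [].
  apply: ler_pM => //; first exact: exprn_ge0.
    rewrite mulr_natl -sumr_const; exact: ler_sum.
  by rewrite /= ler_weXn2l.
apply: le_trans (ler_wpM2l (exprn_ge0 _ t0) interp) _.
have -> : t ^+ l.+1 * (#|T|%:R / delta * F l.+2 ^+ l.+1) =
    F l.+2 ^+ l.+1 * (t ^+ l.+1 * #|T|%:R / delta) by ring.
rewrite mulrAC [leRHS]mulrC ler_wpM2l //; first exact: exprn_ge0.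
by rewrite ler_pdivrMr // -mulrA -exprSr.
Qed.

End GapConflict.

Section GapConflictBound.
Context (R : realType) (T : finType) (M : T -> T -> R).
Hypothesis M_ge0 : forall x y, 0 <= M x y.
Hypothesis M_sym : forall x y, M x y = M y x.
Notation N := (walk_sum M).
Notation f := (return_sum M).
Notation F := (closed_sum M).

(** [conflict_pair_bound] for each pair [(y, z)], summed; both square terms
    are reduced to [f 1 * f l.-1] by log-convexity. *)
Lemma gap_conflict_bound_low (e : rel T) (eta t delta : R) (k l i : nat) :
  sparse e (1 - eta) t -> 0 < eta -> 2 * eta <= 1 -> 1 <= t -> t <= k%:R ->
  k%:R <= 2 * t -> (0 < k)%N -> (k <= #|T|)%N -> 0 < delta ->
  (forall x, f 1 x <= delta^-1) -> (2 <= i <= l)%N ->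
  gap_conflict M e i (2 * l - i) <=
    2 * (t / eta * (F l.-1 / delta)) + 5 * eta * F l.
Proof.
move=> sp eta0 eta1 t1 tk kt k0 kT d0 f1 il.
have t0 : 0 < t by apply: lt_le_trans t1.
have N0 j x y := @walk_sum_ge0 R T M M_ge0 j x y.
have return0 := @return_sum_ge0 R T M.
rewrite (gap_conflict_split M_sym) //.
have through y z j : (j <= l)%N -> \sum_a N j y a * N (l - j) a z = N l y z.
  by move=> jl; rewrite -walk_sumD subnKC.
apply: (@le_trans _ _ (\sum_y \sum_z
    (t / eta * (\sum_a (N 1 y a * N l.-1 a z) ^+ 2 +
                \sum_b (N i.-1 y b * N (l - i.-1) b z) ^+ 2)
     + 5 * eta * N l y z ^+ 2))).
  apply: ler_sum => y _; apply: ler_sum => z _.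
  apply: (conflict_pair_bound sp eta0 eta1 t1 tk kt k0 kT).
  - by move=> x; apply: mulr_ge0.
  - by move=> x; apply: mulr_ge0.
  - by rewrite -(through y z 1%N) ?subn1 //; lia.
  - by apply: through; lia.
under eq_bigr => y _ do rewrite big_split /= -!mulr_sumr big_split /=.
rewrite big_split /= -!mulr_sumr big_split /= !(sum_sqr_through M_sym).
apply: lerD => //.
rewrite mulrCA; apply: ler_wpM2l; first by rewrite divr_ge0 // ltW.
have -> : 2 * (F l.-1 / delta) = F l.-1 / delta + F l.-1 / delta by ring.
have low j k' : (1 <= j)%N -> (1 <= k')%N -> (j + k' = l)%N ->
    \sum_a f j a * f k' a <= F l.-1 / delta.
  move=> j1 k1 jk; rewrite mulr_suml; apply: ler_sum => a _.
  have lc := logconvex_spread (fun m => return0 m a)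
    (fun m => return_sum_logconvex M_sym m a) j1 k1.
  apply: le_trans lc _; rewrite jk mulrC.
  exact: ler_wpM2l.
by apply: lerD; apply: low; lia.
Qed.

Lemma gap_conflict_bound (e : rel T) (eta t delta : R) (k l i : nat) :
  symmetric e ->
  sparse e (1 - eta) t -> 0 < eta -> 2 * eta <= 1 -> 1 <= t -> t <= k%:R ->
  k%:R <= 2 * t -> (0 < k)%N -> (k <= #|T|)%N -> 0 < delta ->
  (forall x, f 1 x <= delta^-1) -> (2 <= i <= 2 * l - 2)%N ->
  gap_conflict M e i (2 * l - i) <=
    2 * (t / eta * (F l.-1 / delta)) + 5 * eta * F l.
Proof.
move=> e_sym sp eta0 eta1 t1 tk kt k0 kT d0 f1 il.
(* A conflict at distance [i > l] is one at distance [2 l - i] backwards. *)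
have [i_le|i_gt] := leqP i l.
  by apply: (gap_conflict_bound_low sp eta0 eta1 t1 tk); lia || by [].
rewrite gap_conflict_sym //.
have {2}-> : (i = 2 * l - (2 * l - i))%N by lia.
by apply: (gap_conflict_bound_low sp eta0 eta1 t1 tk); lia || by [].
Qed.

End GapConflictBound.

(** * Closed walks as tuples *)

Section ClosedWalks.
Context (R : realFieldType) (T : finType) (M : T -> T -> R) (x0 : T).
Notation N := (walk_sum M).

Fixpoint walk_weight (u : T) (s : seq T) : R :=
  if s is x :: s' then M u x * walk_weight x s' else 1.

(** A sequence [s] stands for the closed walk that starts at its last
    element; [x0] only matters for the empty sequence. *)
Definition cycle_weight (s : seq T) : R := walk_weight (last x0 s) s.

Lemma walk_weight_cat u s1 s2 :
  walk_weight u (s1 ++ s2) = walk_weight u s1 * walk_weight (last u s1) s2.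
Proof. by elim: s1 u => [|x s1 IH] u /=; rewrite ?mul1r // IH mulrA. Qed.

Lemma cycle_weight_rot n s : cycle_weight (rot n s) = cycle_weight s.
Proof.
rewrite -[in RHS](cat_take_drop n s) /rot.
case: (take n s) (drop n s) => [|x s1] [|y s2]; rewrite ?cats0 //.
rewrite /cycle_weight !walk_weight_cat !last_cat /= mulrC; congr (_ * _).
Qed.

Lemma sum_tuple0 (G : seq T -> R) : \sum_(s : 0.-tuple T) G s = G [::].
Proof.
rewrite (big_pred1 [tuple]) // => s /=.
by apply/esym/eqP/val_inj; case: s => -[].
Qed.

Lemma sum_tuple_cons k (G : seq T -> R) :
  \sum_(s : k.+1.-tuple T) G s = \sum_x \sum_(s : k.-tuple T) G (x :: s).
Proof.
rewrite pair_big /=.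
rewrite (reindex (fun p : T * k.-tuple T => [tuple of p.1 :: p.2])) //=.
exists (fun s : k.+1.-tuple T => (thead s, [tuple of behead s])).
  by move=> [x s] _ /=; congr (_, _); apply: val_inj.
by move=> s _ /=; rewrite -tuple_eta.
Qed.

Lemma sum_tuple_cat j k (G : seq T -> R) :
  \sum_(s : (j + k).-tuple T) G s =
  \sum_(s1 : j.-tuple T) \sum_(s2 : k.-tuple T) G (s1 ++ s2).
Proof.
elim: j G => [|j IH] G.
  by rewrite (sum_tuple0 (fun s1 => \sum_(s2 : k.-tuple T) G (s1 ++ s2))).
rewrite (sum_tuple_cons _ G) (sum_tuple_cons _
  (fun s1 => \sum_(s2 : k.-tuple T) G (s1 ++ s2))).
by apply: eq_bigr => x _; rewrite (IH (fun s => G (x :: s))).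
Qed.

Lemma sum_walk_weight k u v :
  \sum_(s : k.-tuple T) walk_weight u s * (last u s == v)%:R = N k u v.
Proof.
elim: k u => [|k IH] u.
  rewrite (sum_tuple0 (fun s => walk_weight u s * (last u s == v)%:R)) /=.
  by rewrite mul1r.
rewrite (sum_tuple_cons _ (fun s => walk_weight u s * (last u s == v)%:R)).
rewrite walk_sumS; apply: eq_bigr => x _ /=.
rewrite -IH mulr_sumr; apply: eq_bigr => s _; by rewrite mulrA.
Qed.

(** The start of the walk is its last entry and the other marked vertex is
    its [j]-th step. *)
Lemma sum_cycle_weight_marked j k (g : T -> T -> R) :
  (0 < j)%N -> (0 < k)%N ->
  \sum_(s : (j + k).-tuple T)
     cycle_weight s * g (last x0 s) (nth x0 s j.-1) =
  \sum_a \sum_b N j a b * N k b a * g a b.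
Proof.
move=> j0 k0.
rewrite (sum_tuple_cat _ _ (fun s => cycle_weight s * g (last x0 s) (nth x0 s j.-1))).
have delta2 (a' b' : T) (h : T -> T -> R) :
    h a' b' = \sum_a \sum_b (a == a')%:R * (b == b')%:R * h a b.
  rewrite (bigD1 a') //= [X in _ + X]big1 ?addr0; last first.
    move=> a /negbTE aa; rewrite big1 // => b _; by rewrite aa !mul0r.
  rewrite (bigD1 b') //= [X in _ + X]big1 ?addr0; last first.
    by move=> b /negbTE bb; rewrite bb mulr0 mul0r.
  by rewrite !eqxx !mul1r.
have last_ne n (s : n.-tuple T) u v : (0 < n)%N -> last u s = last v s.
  by case: n s => // n s _; rewrite (tuple_eta s).
(* Summing over the values of the two marked vertices decouples the halves. *)
transitivity (\sum_(s1 : j.-tuple T) \sum_(s2 : k.-tuple T) \sum_a \sum_b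
    (walk_weight a s1 * (last a s1 == b)%:R) *
    (walk_weight b s2 * (last b s2 == a)%:R) * g a b).
  apply: eq_bigr => s1 _; apply: eq_bigr => s2 _.
  rewrite /cycle_weight walk_weight_cat last_cat.
  have -> : nth x0 (s1 ++ s2) j.-1 = last x0 s1.
    by rewrite nth_cat size_tuple prednK // leqnn -nth_last size_tuple.
  rewrite (last_ne _ s2 _ x0 k0) (last_ne _ s1 _ x0 j0).
  rewrite (delta2 _ _ (fun a b => walk_weight a s1 * walk_weight b s2 * g a b)).
  apply: eq_bigr => a _; apply: eq_bigr => b _.
  rewrite (last_ne _ s1 a x0 j0) (last_ne _ s2 b x0 k0).
  rewrite (eq_sym (last x0 s1)) (eq_sym (last x0 s2)); ring.
under eq_bigr => s1 _ do rewrite exchange_big /=.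
rewrite exchange_big /=; apply: eq_bigr => a _.
under eq_bigr => s1 _ do rewrite exchange_big /=.
rewrite exchange_big /=; apply: eq_bigr => b _.
rewrite -!sum_walk_weight big_distrlr /= mulr_suml.
by apply: eq_bigr => s1 _; rewrite mulr_suml.
Qed.

Lemma sum_cycle_weight (l : nat) :
  (0 < l)%N -> \sum_(s : (2 * l).-tuple T) cycle_weight s =
  \sum_a \sum_b N l a b * N l b a.
Proof.
move=> l0; have := sum_cycle_weight_marked (fun _ _ => 1) l0 l0.
rewrite addnn -mul2n.
under eq_bigr => s _ do rewrite mulr1.
move=> ->; apply: eq_bigr => a _; apply: eq_bigr => b _; by rewrite mulr1.
Qed.

(** Rotating the walk by [p + 1] brings position [p] to its start. *)
Lemma sum_cycle_weight_pair m p q (g : T -> T -> R) :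
  (p < q)%N -> (q < m)%N ->
  \sum_(s : m.-tuple T) cycle_weight s * g (nth x0 s p) (nth x0 s q) =
  \sum_a \sum_b N (q - p) a b * N (m - (q - p)) b a * g a b.
Proof.
move=> pq qm; set j := (q - p)%N; set k := (m - j)%N.
have mjk : m = (j + k)%N by rewrite /k /j; lia.
have j0 : (0 < j)%N by rewrite /j; lia.
have k0 : (0 < k)%N by rewrite /k /j; lia.
rewrite -(sum_cycle_weight_marked g j0 k0) -mjk.
rewrite [RHS](reindex_inj
  (h := fun s : m.-tuple T => [tuple of rot p.+1 s])) /=; last first.
  move=> s s' /(congr1 val) /= /rot_inj h; exact: val_inj.
apply: eq_bigr => s _; rewrite cycle_weight_rot.
have sz := size_tuple s.
congr (_ * g _ _).
  rewrite /rot (take_nth x0) ?sz; last by lia.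
  by rewrite last_cat last_rcons.
rewrite /rot nth_cat size_drop sz; case: ltnP; last by rewrite /j; lia.
by move=> _; rewrite nth_drop; congr (nth _ _ _); rewrite /j; lia.
Qed.

End ClosedWalks.

(** * A subgraph of large minimum degree and its normalised adjacency matrix *)

Section MinDegree.
Context (R : realType) (T : finType).

Lemma degreeE (e : rel T) x : (degree e x)%:R = \sum_y (e x y)%:R :> R.
Proof.
rewrite /degree -sum1_card natr_sum [LHS]big_mkcond /=.
by apply: eq_bigr => y _; rewrite inE; case: (e x y).
Qed.

Definition restrict_rel (e : rel T) (S : {set T}) : rel T :=
  fun x y => [&& x \in S, y \in S & e x y].

Lemma restrict_rel_sym (e : rel T) S : symmetric e -> symmetric (restrict_rel e S).
Proof. by move=> e_sym x y; rewrite /restrict_rel e_sym andbCA. Qed.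

(** A set maximising twice its number of edges minus [2 * delta] times its
    size cannot gain by losing a vertex, so all inner degrees are at least
    [delta]; it is nonempty because the whole graph does better than the
    empty set. *)
Lemma min_degree_subgraph (e : rel T) (delta : R) :
  simple_graph e -> 0 < delta ->
  2 * delta * #|T|%:R < \sum_x (degree e x)%:R ->
  exists2 S : {set T}, S != finset.set0 &
    forall x, x \in S -> delta <= (degree (restrict_rel e S) x)%:R.
Proof.
move=> [e_sym e_irr] d0 hT.
pose phi (S : {set T}) : R :=
  \sum_(x in S) \sum_(y in S) (e x y)%:R - 2 * delta * #|S|%:R.
have phiT : 0 < phi finset.setT.
  rewrite /phi cardsT subr_gt0; apply: lt_le_trans hT _.
  under [leRHS]eq_bigl => x do rewrite inE.
  apply: ler_sum => x _; rewrite degreeE.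
  by under [leRHS]eq_bigl => y do rewrite inE.
have phi0 : phi finset.set0 = 0 by rewrite /phi big_set0 cards0 mulr0 subr0.
case: (@arg_maxP _ R {set T} finset.setT xpredT phi isT) => S _ Smax.
exists S.
  apply/eqP => S0; have /= := Smax finset.setT isT.
  by rewrite S0 phi0 => /(lt_le_trans phiT); rewrite ltxx.
move=> x xS; have /= := Smax (S :\ x)%SET isT.
have -> : (degree (restrict_rel e S) x)%:R = \sum_(y in S :\ x) (e x y)%:R :> R.
  rewrite degreeE [RHS]big_mkcond /=; apply: eq_bigr => y _.
  rewrite /restrict_rel xS /= !inE; case: eqVneq => [->|_] /=.
    by rewrite e_irr andbF.
  by case: (y \in S).
set dx := \sum_(y in S :\ x) _.
have cS : #|S|%:R = 1 + #|(S :\ x)%SET|%:R :> R.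
  by rewrite (cardsD1 x S) xS natrD.
have -> : phi S = phi (S :\ x)%SET + 2 * dx - 2 * delta.
  have sumS (F : T -> R) : \sum_(y in S) F y = F x + \sum_(y in (S :\ x)%SET) F y.
    by rewrite (big_setD1 x).
  rewrite /phi cS sumS sumS e_irr add0r -/dx.
  under [X in _ + X - _]eq_bigr => y _ do rewrite sumS e_sym.
  rewrite big_split /= -/dx; ring.
lra.
Qed.

End MinDegree.

Section NormalizedAdjacency.
Context (R : realType) (T : finType) (e : rel T).

Definition norm_adj (x y : T) : R :=
  (e x y)%:R / (Num.sqrt (degree e x)%:R * Num.sqrt (degree e y)%:R).

Lemma norm_adj_ge0 x y : 0 <= norm_adj x y.
Proof. by rewrite /norm_adj divr_ge0 // mulr_ge0 // sqrtr_ge0. Qed.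

Hypothesis e_sym : symmetric e.

Lemma norm_adj_sym x y : norm_adj x y = norm_adj y x.
Proof. by rewrite /norm_adj e_sym (mulrC (Num.sqrt _)). Qed.

Context (delta : R).
Hypothesis delta_gt0 : 0 < delta.
Hypothesis min_degree : forall x y, e x y -> delta <= (degree e x)%:R.

Lemma norm_adj_le x y : norm_adj x y <= delta^-1.
Proof.
rewrite /norm_adj; case: (boolP (e x y)) => exy; last first.
  by rewrite mul0r invr_ge0 ltW.
have dx := min_degree exy; have dy : delta <= (degree e y)%:R.
  by apply: (@min_degree y x); rewrite e_sym.
have sd : 0 < Num.sqrt delta by rewrite sqrtr_gt0.
rewrite mul1r -[in leRHS](sqr_sqrtr (ltW delta_gt0)) expr2.
by rewrite lef_pV2 ?posrE ?mulr_gt0 ?ler_pM ?sqrtr_ge0 ?ler_wsqrtr //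
  sqrtr_gt0; apply: lt_le_trans delta_gt0 _.
Qed.

Lemma norm_adj_eigen x :
  \sum_y norm_adj x y * Num.sqrt (degree e y)%:R = Num.sqrt (degree e x)%:R.
Proof.
have [|[y0 exy0]] : (forall y, e x y = false) \/ exists y, e x y.
    have [|/existsP h] := boolP [exists y, e x y]; last first.
      by left => y; apply/negbTE/negP => exy; apply: h; exists y.
    by move=> /existsP; right.
  move=> ex0; rewrite degreeE !big1 ?sqrtr0 // => y _; rewrite ?ex0 //.
  by rewrite /norm_adj ex0 !mul0r.
have dx : 0 < (degree e x)%:R :> R by apply: lt_le_trans (min_degree exy0).
have sdx : 0 < Num.sqrt (degree e x)%:R :> R by rewrite sqrtr_gt0.
transitivity (\sum_y (e x y)%:R / Num.sqrt (degree e x)%:R : R).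
  apply: eq_bigr => y _; rewrite /norm_adj.
  case: (boolP (e x y)) => exy; last by rewrite !mul0r.
  have dy : 0 < Num.sqrt (degree e y)%:R :> R.
    rewrite sqrtr_gt0; apply: lt_le_trans delta_gt0 _.
    by apply: (@min_degree y x); rewrite e_sym.
  by field; rewrite !gt_eqF.
rewrite -mulr_suml -degreeE -[X in X / _](sqr_sqrtr (ltW dx)).
by rewrite expr2 mulfK // gt_eqF.
Qed.

Lemma norm_adj_return1 x : return_sum norm_adj 1 x <= delta^-1.
Proof.
rewrite /return_sum; under eq_bigr => y _ do rewrite walk_sum1.
have [dx0|dx0] := eqVneq (degree e x) 0%N.
  rewrite big1 ?invr_ge0 ?(ltW delta_gt0) // => y _.
  by rewrite /norm_adj dx0 sqrtr0 mul0r invr0 mulr0 expr0n.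
have dx : 0 < (degree e x)%:R :> R by rewrite ltr0n lt0n.
apply: (@le_trans _ _ (\sum_y (e x y)%:R / ((degree e x)%:R * delta))).
  apply: ler_sum => y _; rewrite /norm_adj.
  case: (boolP (e x y)) => exy; last by rewrite !mul0r expr0n.
  have dy : delta <= (degree e y)%:R.
    by apply: (@min_degree y x); rewrite e_sym.
  have dy0 := lt_le_trans delta_gt0 dy.
  rewrite !mul1r exprVn exprMn !sqr_sqrtr ?ler0n //.
  by rewrite lef_pV2 ?posrE ?mulr_gt0 // ler_pM2l.
rewrite -mulr_suml -degreeE.
by rewrite invfM mulrA divff ?mul1r // gt_eqF.
Qed.

(** For the fixed vector [v], Cauchy-Schwarz gives
    [|v| ^ 4 = (v M^l v) ^ 2 <= tr (M ^ 2l) * |v| ^ 4]. *)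
Lemma norm_adj_closed_ge1 l :
  (exists x y, e x y) -> 1 <= closed_sum norm_adj l.
Proof.
move=> [x1 [y1 exy1]].
pose v x : R := Num.sqrt (degree e x)%:R.
have eig k x : \sum_y walk_sum norm_adj k x y * v y = v x.
  elim: k x => [|k IH] x; first by rewrite /walk_sum sum_delta_l.
  under eq_bigr => y _ do rewrite walk_sumS mulr_suml.
  rewrite exchange_big /= -[RHS]norm_adj_eigen; apply: eq_bigr => z _.
  by rewrite -[in RHS]/(v z) -(IH z) mulr_sumr; apply: eq_bigr => y _; rewrite mulrA.
pose S := \sum_x v x ^+ 2.
have S0 : 0 < S.
  rewrite /S (bigD1 x1) //=; apply: ltr_wpDr.
    by apply: sumr_ge0 => x _; exact: sqr_ge0.
  rewrite sqr_sqrtr ?ler0n //; exact: lt_le_trans (min_degree exy1).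
have quad : S = \sum_(p : T * T) walk_sum norm_adj l p.1 p.2 * (v p.1 * v p.2).
  rewrite -(pair_bigA _ (fun x y => walk_sum norm_adj l x y * (v x * v y))) /=.
  apply: eq_bigr => x _; rewrite expr2 -{2}(eig l x) mulr_sumr.
  by apply: eq_bigr => y _; rewrite mulrCA.
have := sum_CauchySchwarz (fun p : T * T => walk_sum norm_adj l p.1 p.2)
  (fun p => v p.1 * v p.2).
rewrite -quad.
have -> : \sum_(p : T * T) (v p.1 * v p.2) ^+ 2 = S ^+ 2.
  rewrite -(pair_bigA _ (fun x y => (v x * v y) ^+ 2)) /= expr2 big_distrlr /=.
  by apply: eq_bigr => x _; apply: eq_bigr => y _; rewrite exprMn.
have -> : \sum_(p : T * T) walk_sum norm_adj l p.1 p.2 ^+ 2 =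
    closed_sum norm_adj l.
  by rewrite /closed_sum -(pair_bigA _ (fun x y => walk_sum norm_adj l x y ^+ 2)).
by rewrite -[X in X <= _]mul1r ler_pM2r // exprn_gt0.
Qed.

End NormalizedAdjacency.

(** * Conflict-free closed walks and induced cycles *)

Section InducedCycles.
Context (T : finType) (e : rel T) (m : nat).
Hypothesis e_graph : simple_graph e.
Hypothesis m_ge4 : (4 <= m)%N.

(** The upper bound on [q - p] excludes the pair of positions that closes the
    cycle. *)
Definition chord_pair (p q : nat) : bool :=
  (p < q)%N && (2 <= q - p <= m - 2)%N.

Definition induced_cycle_walk (s : m.-tuple T) : bool :=
  [forall i : 'I_m, e (tnth s i) (tnth s (ordS i))] &&
  [forall p : 'I_m, forall q : 'I_m,
     chord_pair p q ==> ~~ conflict e (tnth s p) (tnth s q)].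

(** A conflict-free closed walk visits distinct vertices, because equality
    counts as a conflict, and [i |-> tnth s i] is an isomorphism of the cycle
    onto the subgraph that it induces. *)
Lemma induced_cycle_walkP (s : m.-tuple T) (i j : 'I_m) :
  induced_cycle_walk s ->
  (e (tnth s i) (tnth s j) = cycle_rel i j) /\
  (tnth s i = tnth s j -> i = j).
Proof.
have [e_sym e_irr] := e_graph.
case/andP => /forallP cyc /forallP chordless.
wlog ij : i j / (i < j)%N => [H|].
  have [/H//|ji|/val_inj ->] := ltngtP i j.
    have [h1 h2] := H j i ji; split; last by move=> /esym/h2.
    by rewrite e_sym h1 /cycle_rel orbC.
  split=> //; rewrite e_irr /cycle_rel orbb; apply/esym/negbTE/eqP.
  move=> /(congr1 val) /=; have := ltn_ord j.
  have [jm|jm] := ltnP j.+1 m; first by rewrite modn_small //; lia.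
  move=> jm'; have -> : (j.+1 = m)%N by lia.
  by rewrite modnn; lia.
have [near|far] := boolP (chord_pair i j); last first.
  have adj : cycle_rel i j.
    have jm := ltn_ord j; rewrite /cycle_rel; apply/orP.
    move: far; rewrite /chord_pair ij /= negb_and -!ltnNge => /orP[h|h].
      left; apply/eqP/val_inj => /=; rewrite modn_small; lia.
    right; apply/eqP/val_inj => /=; have -> : (j.+1 = m)%N by lia.
    rewrite modnn; lia.
  have exy : e (tnth s i) (tnth s j).
    case/orP: adj => /eqP ->; first exact: cyc.
    by rewrite e_sym; exact: cyc.
  by rewrite adj exy; split=> // h; move: exy; rewrite h e_irr.
move: (chordless i) => /forallP/(_ j); rewrite near /= /conflict negb_or.
case/andP => /eqP neq /negbTE ->; split=> //.
apply/esym/negbTE; rewrite /cycle_rel; move: near; rewrite /chord_pair ij /=.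
have jm := ltn_ord j => gap; apply/norP; split; apply/eqP.
  move=> /(congr1 val) /=; rewrite modn_small; lia.
move=> /(congr1 val) /=; have [jm1|jm1] := ltnP j.+1 m.
  by rewrite modn_small //; lia.
have -> : (j.+1 = m)%N by lia.
rewrite modnn; lia.
Qed.

Lemma induced_cycle_walk_uniq (s : m.-tuple T) : induced_cycle_walk s -> uniq s.
Proof.
move=> hs; apply/tuple_uniqP => i j.
by have [_] := induced_cycle_walkP i j hs.
Qed.

Lemma induced_cycle_walk_copy (s : m.-tuple T) :
  induced_cycle_walk s ->
  [set x in s]%SET \in induced_copies e (@cycle_rel m).
Proof.
move=> hs; rewrite inE; apply/asboolP.
have mem_s i : tnth s i \in [set x in s]%SET by rewrite inE mem_tnth.
pose h (i : 'I_m) : {x | x \in [set x in s]%SET} := exist _ (tnth s i) (mem_s i).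
have h_inj : injective h.
  move=> i j /(congr1 val) /=.
  by have [_] := induced_cycle_walkP i j hs.
have [g hK gK] : bijective h.
  apply: inj_card_bij h_inj _; rewrite card_sig card_ord.
  rewrite -[X in (_ <= X)%N](size_tuple s); apply: leq_trans (card_size s).
  by apply: subset_leq_card; apply/fintype.subsetP => x; rewrite !inE.
exists g; first by exists h.
move=> x y; rewrite -[in RHS](gK x) -[in RHS](gK y) /induced /=.
by have [] := induced_cycle_walkP (g x) (g y) hs.
Qed.

(** The walks tracing a given copy are orderings of its [m] vertices. *)
Lemma card_induced_cycle_walks :
  (#|[set s : m.-tuple T | induced_cycle_walk s]%SET| <=
   #|induced_copies e (@cycle_rel m)| * m`!)%N.
Proof.
set G := [set s | _]%SET; set Cp := induced_copies _ _.
rewrite -sum1_card (partition_big (fun s : m.-tuple T => [set x in s]%SET) (mem Cp)) /=.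
  rewrite -sum_nat_const; apply: leq_sum => S _.
  rewrite sum1dep_card.
  have [->|[s0]] := set_0Vmem [set s | (s \in G) && ([set x in s] == S)]%SET.
    by rewrite cards0.
  rewrite !inE => /andP[s0G /eqP s0S].
  have cS : #|S| = m.
    rewrite -s0S cardsE; have /card_uniqP -> := induced_cycle_walk_uniq s0G.
    exact: size_tuple.
  rewrite -[X in (_ <= X)%N]ffactnn -[X in (_ <= X ^_ _)%N]cS -card_uniq_tuples.
  apply: subset_leq_card; apply/fintype.subsetP => s; rewrite !inE.
  move=> /andP[sG /eqP <-]; rewrite induced_cycle_walk_uniq // andbT.
  apply/allP => x xs; suff: x \in [set y in s]%SET by [].
  by rewrite inE.
move=> s; rewrite inE; exact: induced_cycle_walk_copy.
Qed.

End InducedCycles.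

(** * Half of the weight is conflict-free *)

Section ChordlessWeight.
Context (R : realFieldType) (T : finType) (M : T -> T -> R) (x0 : T).
Hypothesis M_ge0 : forall x y, 0 <= M x y.

Lemma walk_weight_ge0 u s : 0 <= walk_weight M u s.
Proof. by elim: s u => [|x s IH] u //=; apply: mulr_ge0. Qed.

Lemma walk_weight_le (c : R) u s :
  (forall x y, M x y <= c) -> walk_weight M u s <= c ^+ size s.
Proof.
move=> Mc; elim: s u => [|x s IH] u //=.
by rewrite exprS ler_pM // walk_weight_ge0.
Qed.

Lemma sum_cycle_weight_le m (G : pred (m.-tuple T)) (c : R) :
  (forall x y, M x y <= c) ->
  \sum_(s : m.-tuple T | G s) cycle_weight M x0 s <=
    #|[set s : m.-tuple T | G s]%SET|%:R * c ^+ m.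
Proof.
move=> Mc; rewrite -sum1_card natr_sum mulr_suml.
under [leRHS]eq_bigl => s do rewrite inE.
apply: ler_sum => s _; rewrite mul1r.
by have := walk_weight_le (last x0 s) s Mc; rewrite size_tuple.
Qed.

Lemma walk_weight_path u s :
  walk_weight M u s != 0 -> path (fun x y => M x y != 0) u s.
Proof.
by elim: s u => [|x s IH] u //=; rewrite mulf_eq0 negb_or => /andP[-> /IH].
Qed.

Lemma cycle_weight_step m (s : m.-tuple T) (i : 'I_m) :
  cycle_weight M x0 s != 0 -> M (tnth s i) (tnth s (ordS i)) != 0.
Proof.
move=> /walk_weight_path /(pathP x0) st.
have sz := size_tuple s; have im := ltn_ord i.
rewrite !(tnth_nth x0) /=.
have [im1|im1] := ltnP i.+1 m.
  by rewrite modn_small //; have := st i.+1; rewrite sz => /(_ im1).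
have -> : (i.+1 = m)%N by lia.
rewrite modnn; have := st 0%N; rewrite sz => /(_ ltac:(lia)) /=.
have -> : (i : nat) = m.-1 by lia.
by rewrite -[in m.-1]sz nth_last.
Qed.

(** A union bound over at most [(2 l) ^ 2 = 4 l ^ 2] pairs of positions.  The
    walks use the edges of [M], whereas conflicts are taken in the larger
    graph [e], in which the cycles have to be induced. *)
Lemma chordless_weight_half (e : rel T) (l : nat) :
  (2 <= l)%N ->
  (forall i, (2 <= i <= 2 * l - 2)%N ->
    gap_conflict M e i (2 * l - i) <= closed_sum M l / (8 * l%:R ^+ 2)) ->
  (forall x y, M x y = M y x) ->
  (forall x y, M x y != 0 -> e x y) ->
  closed_sum M l <=
    2 * \sum_(s : (2 * l).-tuple T | induced_cycle_walk e s) cycle_weight M x0 s.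
Proof.
move=> l2 gap M_sym Me; set m := (2 * l)%N.
have l0 : 0 < l%:R :> R by rewrite ltr0n; lia.
set W := closed_sum M l.
have total : \sum_(s : m.-tuple T) cycle_weight M x0 s = W.
  rewrite /m sum_cycle_weight; last by lia.
  apply: eq_bigr => a _; apply: eq_bigr => b _.
  by rewrite expr2 (walk_sum_sym M_sym l b).
pose bad (s : m.-tuple T) (p q : 'I_m) : R :=
  if chord_pair m p q then
    cycle_weight M x0 s * (conflict e (nth x0 s p) (nth x0 s q))%:R else 0.
have cw0 (s : seq T) : 0 <= cycle_weight M x0 s by exact: walk_weight_ge0.
have bad0 s p q : 0 <= bad s p q.
  by rewrite /bad; case: ifP => // _; apply: mulr_ge0.
have bad_sum (p q : 'I_m) : \sum_s bad s p q <= W / (8 * l%:R ^+ 2).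
  rewrite /bad; case: (boolP (chord_pair m p q)) => [|_]; last first.
    rewrite big1 // divr_ge0 //; first exact: closed_sum_ge0.
  case/andP => pq gpq.
  have -> := @sum_cycle_weight_pair R T M x0 m p q
    (fun a b => (conflict e a b)%:R) pq (ltn_ord q).
  exact: gap.
have bad_all : \sum_p \sum_q \sum_s bad s p q <= W / 2.
  apply: (@le_trans _ _ (\sum_(p : 'I_m) \sum_(q : 'I_m) W / (8 * l%:R ^+ 2))).
    by apply: ler_sum => p _; apply: ler_sum => q _; exact: bad_sum.
  have pairs : (m * m)%:R = 4 * l%:R ^+ 2 :> R by rewrite /m !natrM; ring.
  have all_pairs (w : R) : \sum_(p : 'I_m) \sum_(q : 'I_m) w = w * (m * m)%:R.
    by rewrite !sumr_const !card_ord -mulrnA mulr_natr.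
  have halve (w : R) : w / (8 * l%:R ^+ 2) * (4 * l%:R ^+ 2) = w / 2.
    by field; rewrite gt_eqF.
  by rewrite all_pairs pairs halve.
have cover (s : m.-tuple T) : cycle_weight M x0 s <=
    (if induced_cycle_walk e s then cycle_weight M x0 s else 0)
      + \sum_p \sum_q bad s p q.
  case: ifP => [_|ngood]; first by rewrite lerDl; do 2!apply: sumr_ge0 => ? _.
  rewrite add0r; have [->|nz] := eqVneq (cycle_weight M x0 s) 0.
    by do 2!apply: sumr_ge0 => ? _.
  have [p [q [pq cf]]] : exists p q : 'I_m,
      chord_pair m p q /\ conflict e (tnth s p) (tnth s q).
    move: ngood; rewrite /induced_cycle_walk.
    have -> : [forall i : 'I_m, e (tnth s i) (tnth s (ordS i))].
      by apply/forallP => i; apply/Me/cycle_weight_step.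
    move=> /negbT /forallPn[p] /forallPn[q]; rewrite negb_imply negbK.
    by case/andP => ? ?; exists p, q.
  rewrite (bigD1 p) //= (bigD1 q) //= -addrA {1}/bad pq -!tnth_nth cf mulr1.
  rewrite lerDl addr_ge0 //; first exact: sumr_ge0.
  by do 2!apply: sumr_ge0 => ? _.
have : W <= \sum_(s : m.-tuple T | induced_cycle_walk e s) cycle_weight M x0 s + W / 2.
  rewrite -{1}total; apply: le_trans (ler_sum _ (fun s _ => cover s)) _.
  rewrite big_split /= -big_mkcond /= lerD2l.
  rewrite exchange_big /=; under eq_bigr => p _ do rewrite exchange_big /=.
  exact: bad_all.
lra.
Qed.

End ChordlessWeight.

(** With [F l.-1 * t / delta <= eta ^ 2 / 2 * F l] the conflicts of one pair
    weigh at most [(eta + 5 * eta) * F l], which is [F l / (8 l ^ 2)] for the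
    given [eta]; then [chordless_weight_half] leaves weight at least [1 / 2],
    spread over walks of weight at most [delta ^ - 2l]. *)
Lemma sparse_induced_cycle_count (R : realType) (l : nat) (T : finType)
    (e : rel T) (t delta eta : R) (S : {set T}) :
  (2 <= l)%N -> simple_graph e -> 1 <= t -> 0 < delta ->
  48 * l%:R ^+ 2 * eta = 1 ->
  sparse e (1 - eta) t -> 2 * t <= #|T|%:R ->
  S != finset.set0 ->
  (forall x, x \in S -> delta <= (degree (restrict_rel e S) x)%:R) ->
  t ^+ l.-1 * #|T|%:R <= (eta ^+ 2 / 2) ^+ l.-1 * delta ^+ l ->
  delta ^+ (2 * l) <=
    2 * (#|induced_copies e (@cycle_rel (2 * l))| * (2 * l)`!)%:R.
Proof.
move=> l2 e_graph t1 d0 etaE sp tT Sne mindeg hl.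
have [e_sym e_irr] := e_graph.
have len_ge4 : (4 <= 2 * l)%N by lia.
have l0 : 0 < l%:R :> R by rewrite ltr0n; lia.
have l1 : 4 <= l%:R ^+ 2 :> R.
  by have -> : 4 = 2%:R ^+ 2 :> R; [ring | rewrite lerXn2r ?nnegrE ?ler_nat].
have eta0 : 0 < eta.
  have : 0 < 48 * l%:R ^+ 2 * eta by rewrite etaE.
  by rewrite pmulr_rgt0 // mulr_gt0 // exprn_gt0.
have eta1 : 2 * eta <= 1 by nra.
pose e' := restrict_rel e S.
have e'_sym : symmetric e' by exact: restrict_rel_sym.
have min_deg x y : e' x y -> delta <= (degree e' x)%:R.
  by case/and3P => xS _ _; exact: mindeg.
have [x0 x0S] := set0Pn _ Sne.
have edge : exists x y, e' x y.
  have : 0 < (degree e' x0)%:R :> R by apply: lt_le_trans (mindeg _ x0S).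
  rewrite ltr0n /degree => /card_gt0P[y]; rewrite inE => e'xy.
  by exists x0, y.
pose M : T -> T -> R := norm_adj R e'.
have M0 : forall x y, 0 <= M x y by exact: norm_adj_ge0.
have Ms : forall x y, M x y = M y x by exact: norm_adj_sym.
have F1 : 1 <= closed_sum M l := norm_adj_closed_ge1 e'_sym d0 min_deg l edge.
have ret x : return_sum M 1 x <= delta^-1.
  exact (norm_adj_return1 e'_sym d0 min_deg x).
(* An integer between [t] and [2 t], as sizes of sets are integers. *)
pose k := (Num.truncn t).+1.
have t0 : 0 <= t by apply: le_trans t1.
have /andP[kl kr] := truncn_itv t0.
have tk : t <= k%:R by exact: ltW.
have kt : k%:R <= 2 * t by rewrite /k -natr1; lra.
have kT : (k <= #|T|)%N by rewrite -(ler_nat R); apply: le_trans kt tT.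
have pred : t * (closed_sum M l.-1 / delta) <= eta ^+ 2 / 2 * closed_sum M l.
  apply: closed_sum_pred => //.
  by rewrite divr_ge0 // sqr_ge0.
have half := @chordless_weight_half R T M x0 M0 e l l2 _ Ms _.
have M_edge x y : M x y != 0 -> e x y.
  rewrite /M /norm_adj; case: (boolP (e' x y)); last by rewrite mul0r eqxx.
  by case/and3P.
have scale (w : R) : w / (8 * l%:R ^+ 2) = 6 * eta * w.
  transitivity (w / (8 * l%:R ^+ 2) * (48 * l%:R ^+ 2 * eta)).
    by rewrite etaE mulr1.
  by field; rewrite gt_eqF.
have regroup (w : R) :
    6 * eta * w = 2 * (eta^-1 * (eta ^+ 2 / 2 * w)) + 5 * eta * w.
  by field; rewrite gt_eqF.
have {}half : closed_sum M l <=
    2 * \sum_(s : (2 * l).-tuple T | induced_cycle_walk e s) cycle_weight M x0 s.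
  apply: half => // i hi.
  have gb := gap_conflict_bound M0 Ms e_sym sp eta0 eta1 t1 tk kt (ltn0Sn _)
    kT d0 ret hi.
  rewrite scale; apply: le_trans gb _; rewrite regroup.
  rewrite lerD2r ler_pM2l // [t / eta]mulrC -[leLHS]mulrA ler_wpM2l //.
  by rewrite invr_ge0 ltW.
have M_le x y : M x y <= delta^-1.
  exact (norm_adj_le e'_sym d0 min_deg x y).
have weight : \sum_(s : (2 * l).-tuple T | induced_cycle_walk e s) cycle_weight M x0 s
    <= #|[set s : (2 * l).-tuple T | induced_cycle_walk e s]%SET|%:R
         * delta^-1 ^+ (2 * l).
  exact (sum_cycle_weight_le x0 M0 (fun s => induced_cycle_walk e s) M_le).
have count := @card_induced_cycle_walks T e (2 * l) e_graph len_ge4.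
have D0 : 0 < delta ^+ (2 * l) by rewrite exprn_gt0.
move: weight; rewrite exprVn ler_pdivlMr // => weight.
have cnt : #|[set s : (2 * l).-tuple T | induced_cycle_walk e s]%SET|%:R <=
   (#|induced_copies e (@cycle_rel (2 * l))| * (2 * l)`!)%:R :> R by rewrite ler_nat.
apply: (@le_trans _ _ (closed_sum M l * delta ^+ (2 * l))).
  by rewrite ler_peMl // ltW.
apply: le_trans (ler_wpM2r (ltW D0) half) _.
rewrite -mulrA ler_pM2l //; exact: le_trans weight cnt.
Qed.

(** * Counting induced cycles *)

(** The edge threshold in terms of the average degree, without real
    exponents. *)
Lemma powR_threshold (R : realType) (l : nat) (C t n d : R) :
  (2 <= l)%N -> 0 <= C -> 0 <= t -> 0 < n ->
  C * t `^ (1 - l%:R^-1) * n `^ (1 + l%:R^-1) <= d * n ->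
  C ^+ l * t ^+ l.-1 * n <= d ^+ l.
Proof.
move=> l2 C0 t0 n0 h.
have l0 : l%:R != 0 :> R by rewrite pnatr_eq0; lia.
have key : C * t `^ (1 - l%:R^-1) * n `^ l%:R^-1 <= d.
  move: h; rewrite [n `^ _]powRD; last by rewrite (gt_eqF n0) implybT.
  by rewrite powRr1 ?(ltW n0) // mulrCA mulrC ler_pM2r.
have pow0 : 0 <= C * t `^ (1 - l%:R^-1) * n `^ l%:R^-1.
  by rewrite !mulr_ge0 // powR_ge0.
have := lerXn2r l pow0 (le_trans pow0 key) key.
have expE x r : (x `^ r) ^+ l = x `^ (r * l%:R).
  by rewrite powRrM powR_mulrn ?powR_ge0.
rewrite !exprMn !expE mulVf // powRr1 ?(ltW n0) //.
have -> : (1 - l%:R^-1) * l%:R = l.-1%:R :> R.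
  rewrite mulrBl mul1r mulVf //.
  have {1}-> : l = l.-1.+1 by lia.
  by rewrite -natr1 addrK.
by rewrite powR_mulrn.
Qed.

Theorem theorem1p2 (R : realType) (l : nat) (hl : (2 <= l)%N) :
  exists eps C C' : R,
    [/\ 0 < eps, eps < 1, 0 < C' &
      forall (T : finType) (e : rel T) (t : R),
        simple_graph e -> (0 < #|T|)%N -> 1 <= t -> sparse e (1 - eps) t ->
        C * t `^ (1 - l%:R^-1) * #|T|%:R `^ (1 + l%:R^-1) <= #|edges e|%:R ->
        C' * avg_degree R e ^+ (2 * l) <=
          #|induced_copies e (@cycle_rel (2 * l))|%:R].
Proof.
have lE : l = l.-1.+1 by lia.
have pred_gt0 : (0 < l.-1)%N by lia.
have l0 : 0 < l%:R :> R by rewrite ltr0n; lia.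
have l1 : 4 <= l%:R ^+ 2 :> R.
  by have -> : 4 = 2%:R ^+ 2 :> R; [ring | rewrite lerXn2r ?nnegrE ?ler_nat].
pose eta : R := (48 * l%:R ^+ 2)^-1.
have den0 : 0 < 48 * l%:R ^+ 2 :> R by rewrite mulr_gt0 ?exprn_gt0.
have etaE : 48 * l%:R ^+ 2 * eta = 1 by rewrite divff // gt_eqF.
have eta0 : 0 < eta by rewrite invr_gt0.
have eta1 : eta <= 1 / 192 by nra.
pose kappa := eta ^+ 2 / 2.
have kappa0 : 0 < kappa by rewrite divr_gt0 ?exprn_gt0.
have kappa1 : 2 * kappa <= 1 by rewrite /kappa; nra.
(* [4 / kappa] allows for [delta = d / 4] in the degree bound, and so does
   [4 ^+ (2 * l)] in the count. *)
exists eta, (4 / kappa), (2 * 4 ^+ (2 * l) * ((2 * l)`!)%:R)^-1.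
have den : 0 < 2 * 4 ^+ (2 * l) * ((2 * l)`!)%:R :> R.
  by rewrite !mulr_gt0 ?exprn_gt0 // ltr0n fact_gt0.
split; [exact: eta0 | by lra | by rewrite invr_gt0 |].
move=> T e t e_graph T0 t1 sp hedges.
have n0 : 0 < #|T|%:R :> R by rewrite ltr0n.
have t0 : 0 < t by apply: lt_le_trans t1.
set d := avg_degree R e.
have dn : d * #|T|%:R = \sum_x (degree e x)%:R.
  by rewrite /d /avg_degree natr_sum divfK // gt_eqF.
have edges_le : #|edges e|%:R <= d * #|T|%:R.
  rewrite dn -natr_sum ler_nat; apply: leq_trans (leq_imset_card _ _) _.
  have -> : (\sum_x degree e x = \sum_x \sum_y e x y)%N.
    apply: eq_bigr => x _; rewrite /degree -sum1_card [LHS]big_mkcond /=.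
    by apply: eq_bigr => y _; rewrite inE; case: (e x y).
  rewrite pair_bigA /= -sum1_card big_mkcond /=.
  by apply: leq_sum => -[x y] _; rewrite inE; case: (e x y).
have C0 : 0 <= 4 / kappa by rewrite divr_ge0 // ltW.
have := powR_threshold hl C0 (ltW t0) n0 (le_trans hedges edges_le).
set n : R := #|T|%:R => dpow.
have d_ge0 : 0 <= d by rewrite /d /avg_degree divr_ge0.
have dl0 : 0 < d ^+ l.
  apply: lt_le_trans dpow; rewrite !mulr_gt0 ?exprn_gt0 // divr_gt0 //.
have d0 : 0 < d.
  rewrite lt_neqAle d_ge0 andbT eq_sym; apply/eqP => d00.
  by move: dl0; rewrite d00 lE expr0n ltxx.
(* [min_degree_subgraph] needs [2 * delta < d]. *)
pose delta := d / 4.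
have delta0 : 0 < delta by rewrite divr_gt0.
have delta_pow : t ^+ l.-1 * n <= kappa ^+ l * delta ^+ l.
  have -> : kappa ^+ l * delta ^+ l = d ^+ l / (4 / kappa) ^+ l.
    by rewrite /delta -exprMn -expr_div_n; congr (_ ^+ l); field; rewrite gt_eqF.
  by rewrite ler_pdivlMr ?exprn_gt0 ?divr_gt0 // mulrC mulrA.
have delta_n : delta <= n.
  have : d <= n.
    rewrite -(ler_pM2r n0) dn [leRHS]mulr_natr -sumr_const.
    by apply: ler_sum => x _; rewrite ler_nat max_card.
  by rewrite /delta; lra.
have kappa_delta : kappa * delta <= n / 2.
  have kappa_half : kappa <= 1 / 2 by lra.
  apply: le_trans (ler_wpM2r (ltW delta0) kappa_half) _; lra.
(* Sparseness is only useful for sets of about [t] vertices, which have to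
   exist; [delta <= n] turns the degree bound into this. *)
have tT : 2 * t <= n.
  have : t ^+ l.-1 <= (kappa * delta) ^+ l.-1.
    rewrite -(ler_pM2r n0); apply: le_trans delta_pow _.
    rewrite -exprMn {1}lE exprSr ler_wpM2l //; last by lra.
    by rewrite exprn_ge0 // mulr_ge0 // ltW.
  rewrite (ler_pXn2r pred_gt0) ?nnegrE ?(ltW t0) //; last first.
    by rewrite mulr_ge0 // ltW.
  by lra.
have [|S Sne mindeg] := @min_degree_subgraph R T e delta e_graph delta0.
  by rewrite -dn -/n /delta ltr_pM2r //; lra.
have hl' : t ^+ l.-1 * n <= kappa ^+ l.-1 * delta ^+ l.
  apply: le_trans delta_pow _; rewrite ler_wpM2r ?exprn_ge0 ?(ltW delta0) //.
  by rewrite {1}lE exprS ler_piMl ?exprn_ge0 ?(ltW kappa0) //; lra.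
have := sparse_induced_cycle_count hl e_graph t1 delta0 etaE sp tT Sne mindeg hl'.
rewrite /delta expr_div_n ler_pdivrMr ?exprn_gt0 // => count.
rewrite mulrC ler_pdivrMr //; apply: le_trans count _.
have regroup (a b c : R) : 2 * (a * b) * c = a * (2 * c * b) by ring.
by rewrite natrM regroup.
Qed.
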